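(* Let $(W,S)$ be a Coxeter system with $W$ infinite and $|S|\le\aleph_0$. Then the poset $(\overline{W},\leq)$ contains maximal elements, and every element $w\in\overline{W}$ is less than or equal to some maximal element.
   Context: $\Phi$ is the root system of $(W,S)$ (in the standard reflection representation), $\Phi^+$ and $\Phi^-=-\Phi^+$ the sets of positive and negative roots. For $w\in W$ put $\Phi_w=\{\alpha\in\Phi^+ : w^{-1}(\alpha)\in\Phi^-\}$. An infinite reduced expression is a sequence $s_1s_2s_3\cdots$ with $s_i\in S$ such that $s_1s_2\cdots s_k$ is a reduced expression for every $k\ge 1$; put $\Phi_{s_1s_2s_3\cdots}=\bigcup_{i\ge1}\Phi_{s_1s_2\cdots s_i}$. Two infinite reduced expressions are equivalent if the associated sets $\Phi_{s_1s_2\cdots}$ are equal. $W_l$ is the set of equivalence classes (infinite reduced words), $\Phi_w$ for $w\in W_l$ is the common set attached to the class, and $\overline{W}=W_l\uplus W$ (disjoint union). The weak order on $\overline{W}$ is: $x\le y$ if and only if $\Phi_x\subset\Phi_y$. *)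

(* Defs.v *)
From HB Require Import structures.
From mathcomp Require Import all_boot all_order all_algebra.
From mathcomp Require Import all_classical all_reals trigo.
From mathcomp.multinomials Require Import freeg.
From mathcomp Require Import ring.

Set Implicit Arguments.
Unset Strict Implicit.
Unset Printing Implicit Defensive.

Import Order.TTheory GRing.Theory Num.Theory.

Local Open Scope classical_set_scope.
Local Open Scope ring_scope.
Local Open Scope quotient_scope.

Section CoxeterSystem.
Variable W : groupType.
Local Open Scope group_scope.

(* [gorder x = 0] encodes infinite order; then [x ^+ gorder x = 1] always. *)
Definition gorder (x : W) : nat :=
  xget 0%N [set n | [/\ (0 < n)%N, x ^+ n = 1
                      & forall k, (0 < k < n)%N -> x ^+ k <> 1]].

Variable S : set W.

Definition word_prod (e : seq S) : W := \prod_(s <- e) val s.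

Definition coxm (s t : S) : nat := gorder (val s * val t).

(* Bourbaki, Lie IV.1.3. No inverses are needed in [cox_gen] since the elements
   of S are involutions. [cox_univ] is the universal property of the
   presentation with generators S and relations (st)^m(s,t) = 1, m(s,t) finite:
   when m(s,t) is infinite, [coxm s t = 0] and the relation is void. *)
Record coxeter_system : Prop := CoxeterSystem {
  cox_order2 : forall s : S, gorder (val s) = 2%N;
  cox_gen : forall w : W, exists e : seq S, word_prod e = w;
  cox_univ : forall (G : groupType) (f : S -> G),
    (forall s t : S, (f s * f t) ^+ coxm s t = 1) ->
    exists g : {multiplicative W -> G}, forall s : S, g (val s) = f s
}.

Definition reduced_expr (e : seq S) : Prop :=
  forall e' : seq S, word_prod e' = word_prod e -> (size e <= size e')%N.

Definition inf_reduced : set (nat -> S) :=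
  [set a | forall k, (1 <= k)%N -> reduced_expr (mkseq a k)].

End CoxeterSystem.

Arguments inf_reduced {W} S _.

Section RootSystem.
Variables (R : realType) (W : groupType) (S : set W).

Local Notation V := {freeg S / R}.

Definition cox_gram (s t : S) : R :=
  if coxm s t == 0%N then -1 else - cos (pi / (coxm s t)%:R).

Definition cox_form (u v : V) : R :=
  fglift (fun s => fglift (fun t => cox_gram s t : R^o) v : R^o) u.

Definition simple_root (s : S) : V := << s >>.

Definition simple_refl (s : S) (v : V) : V :=
  v - (2 * cox_form (simple_root s) v) *: simple_root s.

Definition is_std_rep (rho : W -> V -> V) : Prop :=
  [/\ forall w, linear (rho w),
      rho 1%g = id,
      forall x y, rho (x * y)%g = rho x \o rho y
    & forall s : S, rho (val s) = simple_refl s].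

(* The standard reflection representation; see [std_repP] and [std_rep_uniq]
   below for its existence and uniqueness. *)
Definition std_rep : W -> V -> V :=
  @xget (W -> V -> V : choiceType) (fun=> id) [set rho | is_std_rep rho].

Definition root_system : set V :=
  [set v | exists w s, v = std_rep w (simple_root s)].

Definition pos_root : set V :=
  [set v | root_system v /\ forall s : S, 0 <= coeff s v].

Definition neg_root : set V := [set v | pos_root (- v)].

Definition inversions (w : W) : set V :=
  [set v | pos_root v /\ neg_root (std_rep w^-1%g v)].

Definition inf_inversions (a : inf_reduced S) : set V :=
  \bigcup_(i in [set i | (1 <= i)%N]) inversions (word_prod (mkseq (val a) i)).

Definition inf_equiv : rel (inf_reduced S) :=
  fun a b => `[< inf_inversions a = inf_inversions b >].

Lemma inf_equiv_is_equiv : equiv_class_of inf_equiv.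
Proof.
split=> [a|a b|b a c]; first exact/asboolP.
- by apply/asboolP/asboolP => ->.
- by move=> /asboolP ab /asboolP bc; apply/asboolP; rewrite ab.
Qed.

Canonical inf_equiv_equiv := EquivRelPack inf_equiv_is_equiv.

Definition inf_word := {eq_quot inf_equiv}.

HB.instance Definition _ := Choice.on inf_word.
HB.instance Definition _ := EqQuotient.on inf_word.

Definition inf_word_inversions (x : inf_word) : set V :=
  inf_inversions (repr x).

Lemma inf_word_inversions_pi (a : inf_reduced S) :
  inf_word_inversions (\pi_inf_word a) = inf_inversions a.
Proof. by apply/asboolP; rewrite -[`[< _ >]]/(inf_equiv _ _) -eqmodE reprK. Qed.

Definition Wbar : Type := (inf_word + W)%type.

Definition Wbar_inversions (x : Wbar) : set V :=
  match x with
  | inl c => inf_word_inversions c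
  | inr w => inversions w
  end.

Definition weak_le (x y : Wbar) : Prop :=
  Wbar_inversions x `<=` Wbar_inversions y.

Definition weak_maximal (x : Wbar) : Prop :=
  forall y : Wbar, weak_le x y -> y = x.

End RootSystem.

Arguments root_system R {W} S _.
Arguments pos_root R {W} S _.
Arguments neg_root R {W} S _.
Arguments std_rep R {W} S _ _.

Section GOrder.
Variable W : groupType.
Implicit Types x y : W.
Local Open Scope group_scope.

Lemma expg_gorder x : x ^+ gorder x = 1.
Proof. by rewrite /gorder; case: xgetP => // n _ []. Qed.

Lemma gorderC x y : gorder (x * y) = gorder (y * x).
Proof.
have E (u v : W) n : (u * v) ^+ n = 1 -> (v * u) ^+ n = 1.
  have -> : v * u = (u * v) ^ u by rewrite conjgE !mulgA mulVg mul1g.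
  by rewrite -conjXg => ->; rewrite conj1g.
have E' (u v : W) n : (u * v) ^+ n <> 1 -> (v * u) ^+ n <> 1 by move=> h /E.
congr (xget 0%N _); apply/seteqP.
by split=> n [n0 /E e h]; split=> // k /h /E'.
Qed.

Lemma gorder1 : gorder (1 : W) = 1%N.
Proof.
rewrite /gorder; case: xgetP => [n _ [n0 _ h]|/(_ 1%N) []].
  case: n n0 h => // -[//|n] _ /(_ 1%N isT) []; exact: expg1n.
by split=> // k; case: k.
Qed.

End GOrder.

Section Bij.
Variable T : Type.

Record bij := Bij {
  bij_fun :> T -> T; bij_inv : T -> T;
  bijK : cancel bij_fun bij_inv; bijVK : cancel bij_inv bij_fun }.

HB.instance Definition _ := gen_eqMixin bij.
HB.instance Definition _ := gen_choiceMixin bij.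

Lemma bijP (f g : bij) : f =1 g -> f = g.
Proof.
case: f g => f f' fK f'K [g g' gK g'K] /= /funext fg; case: _ / fg gK g'K => gK g'K.
have fg' : f' = g' by apply/funext => x; rewrite -{1}(g'K x) fK.
by case: _ / fg' gK g'K => gK g'K; congr Bij; exact: Prop_irrelevance.
Qed.

Definition bij_one := @Bij id id (frefl id) (frefl id).
Definition bij_opp (f : bij) := Bij (@bijVK f) (@bijK f).
Definition bij_mul (f g : bij) :=
  Bij (can_comp (@bijK f) (@bijK g)) (can_comp (@bijVK g) (@bijVK f)).

Fact bij_mulA : associative bij_mul. Proof. by move=> *; apply: bijP. Qed.
Fact bij_mul1 : left_id bij_one bij_mul. Proof. by move=> *; apply: bijP. Qed.
Fact bij_1mul : right_id bij_one bij_mul. Proof. by move=> *; apply: bijP. Qed.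
Fact bij_mulV : left_inverse bij_one bij_opp bij_mul.
Proof. by move=> f; apply: bijP => x; exact: bijK. Qed.
Fact bij_Vmul : right_inverse bij_one bij_opp bij_mul.
Proof. by move=> f; apply: bijP => x; exact: bijVK. Qed.

HB.instance Definition _ :=
  isGroup.Build bij bij_mulA bij_mul1 bij_1mul bij_mulV bij_Vmul.

Lemma bij_exp (f : bij) n x : (f ^+ n)%g x = iter n f x.
Proof. by elim: n => // n IHn; rewrite expgS /= -IHn. Qed.

End Bij.

Section StdRep.
Variables (R : realType) (W : groupType) (S : set W).
Hypothesis coxWS : coxeter_system S.
Local Notation V := {freeg S / R}.
Implicit Types (s t : S) (u v : V).

Lemma coxmss s : coxm s s = 1%N.
Proof.
rewrite /coxm -(gorder1 W); congr gorder.
by have := expg_gorder (val s); rewrite (cox_order2 coxWS) expg2.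
Qed.

Lemma coxm_gt1 s t : s != t -> coxm s t != 1%N.
Proof.
apply: contra_neq => m1; apply: val_inj.
have := expg_gorder (val s * val t); rewrite -/(coxm s t) m1 expg1 => st1.
have tt : (val t * val t = 1)%g.
  by have := expg_gorder (val t); rewrite (cox_order2 coxWS) expg2.
by rewrite -[LHS]mulg1 -tt mulgA st1 mul1g.
Qed.

Lemma fgliftD (f : S -> R^o) (u v : V) :
  fglift f (u + v) = fglift f u + fglift f v.
Proof.
have fB := lift_is_additive f.
have f0 : fglift f 0 = 0 by have := fB 0 0; rewrite !subrr.
have fN w : fglift f (- w) = - fglift f w by rewrite -sub0r fB f0 sub0r.
by rewrite -[v in LHS]opprK fB fN opprK.
Qed.

Lemma fglift_linear (f : S -> R^o) (a : R) (u v : V) :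
  fglift f (a *: u + v) = a * fglift f u + fglift f v.
Proof.
rewrite fgliftD; congr (_ + _).
have fsum (c : S -> R) :
    fglift f (\sum_(x <- dom u) << c x *g x >>) = \sum_(x <- dom u) c x * f x.
  rewrite (big_morph (fglift f) (fgliftD f) (_ : _ = 0)); last first.
    by have := lift_is_additive f 0 0; rewrite !subrr.
  by apply: eq_bigr => x _; rewrite liftU.
rewrite -[u in RHS]freeg_sumE fsum /GRing.scale/= /fgscale fsum mulr_sumr.
by apply: eq_bigr => x _; rewrite mulrA.
Qed.

Lemma cox_formE s v :
  cox_form (simple_root R s) v = fglift (fun t => cox_gram R s t : R^o) v.
Proof. by rewrite /cox_form liftU scale1r. Qed.

Lemma cox_form_linear s (a : R) (u v : V) :
  cox_form (simple_root R s) (a *: u + v) =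
  a * cox_form (simple_root R s) u + cox_form (simple_root R s) v.
Proof. by rewrite !cox_formE fglift_linear. Qed.

Lemma cox_form_simple s t :
  cox_form (simple_root R s) (simple_root R t) = cox_gram R s t.
Proof. by rewrite cox_formE liftU scale1r. Qed.

Lemma cox_gramC s t : cox_gram R s t = cox_gram R t s.
Proof. by rewrite /cox_gram /coxm gorderC. Qed.

Lemma cox_gramss s : cox_gram R s s = 1.
Proof. by rewrite /cox_gram coxmss/= divr1 cospi opprK. Qed.

Lemma simple_refl_linear s : linear (simple_refl (R := R) s).
Proof.
move=> a u v; rewrite /simple_refl cox_form_linear scalerBr scalerA.
by rewrite mulrDr scalerDl opprD addrACA mulrCA.
Qed.

Lemma simple_reflK s : involutive (simple_refl (R := R) s).
Proof.
move=> v; rewrite {1}/simple_refl.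
have -> : cox_form (simple_root R s) (simple_refl s v) = - cox_form (simple_root R s) v.
  rewrite /simple_refl addrC -scaleNr cox_form_linear cox_form_simple cox_gramss; ring.
by rewrite /simple_refl mulrN scaleNr opprK subrK.
Qed.


Lemma refl2_step s t v (c x y p q : R) :
  cox_gram R s t = - c ->
  cox_form (simple_root R s) v = x - c * y ->
  cox_form (simple_root R t) v = y - c * x ->
  let q' := 2 * c * p - q in let p' := 2 * c * q' - p in
  simple_refl s (simple_refl t (v + (p - x) *: simple_root R s + (q - y) *: simple_root R t)) =
  v + (p' - x) *: simple_root R s + (q' - y) *: simple_root R t.
Proof.
move=> gst hx hy q' p'.
have F r a b :
    cox_form (simple_root R r) (v + a *: simple_root R s + b *: simple_root R t)
    = b * cox_gram R r t + (a * cox_gram R r s + cox_form (simple_root R r) v).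
  by rewrite addrC cox_form_linear [v + _]addrC cox_form_linear !cox_form_simple.
rewrite [simple_refl t _]/simple_refl F cox_gramss (cox_gramC t s) gst hy -addrA -scalerBl.
have -> : q - y - 2 * ((q - y) * 1 + ((p - x) * - c + (y - c * x))) = q' - y by rewrite /q'; ring.
rewrite /simple_refl F cox_gramss gst hx addrAC -[v + _ - _]addrA -scalerBl.
by congr (_ + _ *: _ + _); rewrite /p'; ring.
Qed.

Lemma refl2_iter s t v n (th x y : R) :
  let z k := (x * sin (k * th) - y * sin (k * th - th)) / sin th in
  cox_gram R s t = - cos th -> sin th != 0 ->
  cox_form (simple_root R s) v = x - cos th * y ->
  cox_form (simple_root R t) v = y - cos th * x ->
  iter n (simple_refl s \o simple_refl t) v =
  v + (z (n.*2.+1)%:R - x) *: simple_root R s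
    + (z n.*2%:R - y) *: simple_root R t.
Proof.
move=> z gst sth hx hy.
have zS k : z k.+2%:R = 2 * cos th * z k.+1%:R - z k%:R.
  rewrite /z -!natr1 !mulrDl !mul1r !addrK !sinD !cosD sinN cosN.
  move: sth (sin2cos2 th); set c := cos th; set d := sin th.
  by move=> d0 cd; field : cd.
elim: n => [|n IHn].
  by rewrite /z !mul0r mul1r subrr sub0r sinN sin0 !mulr0 subr0 sub0r
             mulrN opprK !mulfK // !subrr !scale0r !addr0.
by rewrite iterS {}IHn /= (refl2_step _ _ gst hx hy) -!zS.
Qed.

Lemma refl_coxm s t v : iter (coxm s t) (simple_refl s \o simple_refl t) v = v.
Proof.
have [->|st] := eqVneq s t; first by rewrite coxmss /= simple_reflK.
have [m0|m0] := eqVneq (coxm s t) 0%N; first by rewrite m0.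
set m := coxm s t; set th : R := pi / m%:R.
have m1 : (1 < m)%N by rewrite ltn_neqAle eq_sym coxm_gt1 ?lt0n.
have mR : (1 : R) < m%:R by rewrite ltr1n.
have sth : sin th != 0.
  rewrite gt_eqF// sin_gt0_pi// divr_gt0 ?pi_gt0 ?(lt_trans ltr01)//=.
  by rewrite ltr_pdivrMr ?(lt_trans ltr01)// ltr_pMr ?pi_gt0.
have gst : cox_gram R s t = - cos th by rewrite /cox_gram (negPf m0).
pose a := cox_form (simple_root R s) v; pose b := cox_form (simple_root R t) v.
have c2 := sin2cos2 th.
rewrite (@refl2_iter s t v m th ((a + cos th * b) / sin th ^+ 2)
                                ((b + cos th * a) / sin th ^+ 2)) //; first last.
- by rewrite -/b; field : c2.
- by rewrite -/a; field : c2.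
have mth : (m.*2)%:R * th = pi *+ 2.
  rewrite -mul2n natrM -mulrA /th [m%:R * _]mulrC divfK ?mulr_natl//.
  by rewrite gt_eqF// (lt_trans ltr01).
have -> : (m.*2.+1)%:R * th = th + pi *+ 2.
  by rewrite -(@natr1 _ m.*2) mulrDl mul1r mth addrC.
rewrite mth [_ + _ - th]addrAC subrr add0r [pi *+ 2 - _]addrC !sinD2pi sin2pi sinN.
by rewrite !mulr0 subr0 sub0r mulrN opprK !mulfK// !subrr !scale0r !addr0.
Qed.

Lemma std_rep_ex : exists rho : W -> V -> V, is_std_rep rho.
Proof.
pose f s : bij V := Bij (@simple_reflK s) (@simple_reflK s).
have fm s t : ((f s * f t) ^+ coxm s t = 1)%g.
  by apply: bijP => v; rewrite bij_exp; exact: refl_coxm.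
have [g gE] := cox_univ coxWS fm.
have g1 : (g 1 = 1)%g.
  by apply: (@mulgI _ (g 1%g)); rewrite -gmulfM !mulg1.
exists (fun w => bij_fun (g w)); split.
- move=> w; have [e <-] := cox_gen coxWS w; rewrite /word_prod.
  elim: e => [|s e IHe] a u v; first by rewrite big_nil g1.
  by rewrite big_cons gmulfM gE /= IHe simple_refl_linear.
- by apply/funext => v; rewrite g1.
- by move=> x y; apply/funext => v; rewrite gmulfM.
- by move=> s; apply/funext => v; rewrite gE.
Qed.

Lemma std_repP : is_std_rep (std_rep R S).
Proof. exact: xgetPex std_rep_ex. Qed.

Lemma std_rep_uniq (rho : W -> V -> V) :
  is_std_rep rho -> rho = std_rep R S.
Proof.
move=> [_ r1 rM rS]; have [_ s1 sM sS] := std_repP.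
apply/funext => w; have [e <-] := cox_gen coxWS w; rewrite /word_prod.
elim: e => [|s e IHe]; first by rewrite big_nil r1 s1.
by rewrite big_cons rM sM IHe rS sS.
Qed.

End StdRep.

(* Main.v *)
(* The inversion sets of the elements of W below a given element of the
   completed weak order form a directed family with union its inversion set.
   Conversely, as W is countable, every directed family of inversion sets of
   elements of W has a cofinal increasing sequence; either it has a greatest
   element or it refines to an infinite reduced expression, so in both cases its
   union is the inversion set of an element of the completion. Zorn's lemma on
   directed subsets of W containing the elements below w then yields a maximal
   element above w. *)
Require Import Defs.
From mathcomp Require Import all_boot all_order all_algebra.
From mathcomp Require Import all_classical all_reals trigo.
From mathcomp.multinomials Require Import freeg.
From mathcomp Require Import ring zify.

Set Implicit Arguments.
Unset Strict Implicit.
Unset Printing Implicit Defensive.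

Import Order.TTheory GRing.Theory Num.Theory.

(** * Length function, parity and alternating words *)

Section Length.
Variables (W : groupType) (S : set W).
Hypothesis coxWS : coxeter_system S.
Local Open Scope group_scope.
Implicit Types (u v w : W) (s t : S) (e : seq S).

Lemma gen_sq s : val s * val s = 1.
Proof. by have := expg_gorder (val s); rewrite (cox_order2 coxWS) expg2. Qed.

Lemma gen_inv s : (val s)^-1 = val s.
Proof. by rewrite (mulg1_eq (gen_sq s)). Qed.

Lemma mulg_genK w s : w * val s * val s = w.
Proof. by rewrite -mulgA gen_sq mulg1. Qed.

Lemma word_prod_nil : word_prod ([::] : seq S) = 1. Proof. exact: big_nil. Qed.

Lemma word_prod_cons s e : word_prod (s :: e) = val s * word_prod e.
Proof. exact: big_cons. Qed.

Lemma word_prod_cat e1 e2 : word_prod (e1 ++ e2) = word_prod e1 * word_prod e2.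
Proof. exact: big_cat. Qed.

Lemma word_prod1 s : word_prod [:: s] = val s.
Proof. by rewrite word_prod_cons word_prod_nil mulg1. Qed.

Lemma word_prod_rcons e s : word_prod (rcons e s) = word_prod e * val s.
Proof. by rewrite -cats1 word_prod_cat word_prod1. Qed.

Lemma word_prod_rev e : word_prod (rev e) = (word_prod e)^-1.
Proof.
elim: e => [|s e IHe]; first by rewrite word_prod_nil invg1.
by rewrite rev_cons word_prod_rcons word_prod_cons IHe invgM gen_inv.
Qed.

Fact len_subproof w :
  exists n, `[< exists2 e : seq S, word_prod e = w & size e = n >].
Proof. by have [e ew] := cox_gen coxWS w; exists (size e); apply/asboolP; exists e. Qed.

Definition len w : nat := ex_minn (len_subproof w).

Lemma len_word w : exists2 e : seq S, word_prod e = w & size e = len w.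
Proof. by rewrite /len; case: ex_minnP => n /asboolP. Qed.

Lemma len_word_prod e : (len (word_prod e) <= size e)%N.
Proof. by rewrite /len; case: ex_minnP => n _; apply; apply/asboolP; exists e. Qed.

Lemma reduced_exprE e : reduced_expr e <-> len (word_prod e) = size e.
Proof.
split=> [red|le_e e' ee']; last by rewrite -le_e -ee' len_word_prod.
have [e' ee' le'] := len_word (word_prod e).
by apply/eqP; rewrite eqn_leq len_word_prod -le' red.
Qed.

Lemma len1 : len 1 = 0%N.
Proof. by have := len_word_prod ([::] : seq S); rewrite word_prod_nil leqn0 => /eqP. Qed.

Lemma len0 w : len w = 0%N -> w = 1.
Proof.
by have [[|s e] <- <-] := len_word w; first by rewrite word_prod_nil.
Qed.

Lemma lenM u v : (len (u * v) <= len u + len v)%N.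
Proof.
have [e <- <-] := len_word u; have [f <- <-] := len_word v.
by rewrite -word_prod_cat -size_cat len_word_prod.
Qed.

Lemma lenV u : len u^-1 = len u.
Proof.
have le v : (len v^-1 <= len v)%N.
  by have [e <- <-] := len_word v; rewrite -word_prod_rev -size_rev len_word_prod.
by apply/eqP; rewrite eqn_leq le -{1}[u]invgK le.
Qed.

Lemma len_gen s : (len (val s) <= 1)%N.
Proof. by rewrite -word_prod1 len_word_prod. Qed.

(** The universal property yields the sign character of [W]: every generator goes to the negation of
    [bool], and the relations hold since any product of two generators goes to 1. Evaluating at
    [false] reads off the parity of any word. *)
Lemma odd_len e : odd (len (word_prod e)) = odd (size e).
Proof.
pose neg := @Defs.Bij bool negb negb negbK negbK.
have negneg (s t : S) : (neg * neg) ^+ coxm s t = 1.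
  have -> : neg * neg = 1 by apply: bijP => b; exact: negbK.
  exact: expg1n.
have [g gE] := cox_univ coxWS (f := fun=> neg) negneg.
have g1 : g 1 = 1 by apply: (@mulgI _ (g 1)); rewrite -gmulfM !mulg1.
have gword e' : g (word_prod e') false = odd (size e').
  elim: e' => [|s e' IHe]; first by rewrite word_prod_nil g1.
  by rewrite word_prod_cons gmulfM gE /= IHe.
by have [e' ee' <-] := len_word (word_prod e); rewrite -!gword ee'.
Qed.

(** A generator changes the length by at most one, and parity excludes equality. *)
Lemma len_mulr_gen w s :
  len (w * val s) = (len w).+1 \/ len w = (len (w * val s)).+1.
Proof.
have [e ew le] := len_word w.
have := odd_len (rcons e s); rewrite word_prod_rcons ew size_rcons le.
have := leq_trans (lenM w (val s)) (leq_add (leqnn _) (len_gen s)).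
have := leq_trans (lenM (w * val s) (val s)) (leq_add (leqnn _) (len_gen s)).
rewrite mulg_genK; move: (len _) (len _) => m n; rewrite /= => mn nm om.
have mnE : n <> m by move=> nmE; move: om; rewrite nmE; case: odd.
lia.
Qed.

Lemma lenW_ind (P : W -> Prop) : P 1 ->
  (forall u s, len (u * val s) = (len u).+1 -> P u -> P (u * val s)) ->
  forall w, P w.
Proof.
move=> P1 PS w; move: {2}(len w) (erefl (len w)) => n.
elim: n w => [|n IHn] w wn; first by rewrite (len0 wn).
have [e ew we] := len_word w; rewrite wn in we.
case/lastP: e ew we => [|e s] ew; rewrite ?size_rcons// => -[en].
have le : len (word_prod e) = n.
  apply/eqP; rewrite eqn_leq -{1}en len_word_prod /=.
  have := leq_trans (lenM (word_prod e) (val s)) (leq_add (leqnn _) (len_gen s)).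
  by rewrite -word_prod_rcons ew wn addn1.
rewrite -ew word_prod_rcons; apply: PS; last exact: IHn.
by rewrite -word_prod_rcons ew wn le.
Qed.

(** A shorter word for the prefix, followed by the rest of [e], would shorten [e]. *)
Lemma reduced_take e k : reduced_expr e -> reduced_expr (take k e).
Proof.
move=> red f fe; have := red (f ++ drop k e).
rewrite word_prod_cat fe -word_prod_cat cat_take_drop => /(_ erefl).
by rewrite -{1}[e](cat_take_drop k) !size_cat leq_add2r.
Qed.

(* Built from the left, so that the word always ends in [t]. *)
Fixpoint alt s t k : seq S :=
  if k is k'.+1 then (if odd k' then s else t) :: alt s t k' else [::].

Lemma size_alt s t k : size (alt s t k) = k.
Proof. by elim: k => //= k ->. Qed.

Lemma altSr s t k : alt s t k.+1 = rcons (alt t s k) t.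
Proof. by elim: k => //= k <-; case: odd. Qed.

(** Removing the last letters of both words leaves [t (s t)^k s], that is [(t s)^(k+1)]. *)
Lemma alt_quot s t k :
  (word_prod (alt s t k))^-1 * word_prod (alt t s k) = (val t * val s) ^+ k.
Proof.
elim: k s t => [|k IHk] s t; first by rewrite word_prod_nil invg1 mulg1.
rewrite !altSr !word_prod_rcons invgM gen_inv !mulgA -[val t * _ * _]mulgA IHk.
elim: k {IHk} => [|k IHk]; first by rewrite mulg1.
by rewrite !expgSr in IHk *; rewrite -IHk !mulgA.
Qed.

(** The braid relation: for this [k] the power in [alt_quot] is 1. *)
Lemma alt_coxm s t : word_prod (alt s t (coxm s t)) = word_prod (alt t s (coxm s t)).
Proof.
have := alt_quot s t (coxm s t); rewrite /coxm gorderC expg_gorder.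
by move/mulg1_eq; rewrite invgK.
Qed.

End Length.

(** * Positivity of the roots made by length-increasing generators *)

Section Positivity.
Variables (R : realType) (W : groupType) (S : set W).
Hypothesis coxWS : coxeter_system S.
Local Open Scope ring_scope.
Local Notation V := {freeg S / R}.
Local Notation rho := (std_rep R S).
Local Notation alpha := (@simple_root R W S).
Local Notation len := (len coxWS).
Implicit Types (w : W) (s t : S) (x y : V).

Lemma rhoM w1 w2 x : rho (w1 * w2)%g x = rho w1 (rho w2 x).
Proof. by have [_ _ -> _] := std_repP R coxWS. Qed.

Lemma rho1 x : rho 1%g x = x.
Proof. by have [_ -> _ _] := std_repP R coxWS. Qed.

Lemma rho_gen s x : rho (val s) x = simple_refl s x.
Proof. by have [_ _ _ ->] := std_repP R coxWS. Qed.

Lemma rhoK w x : rho w^-1%g (rho w x) = x.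
Proof. by rewrite -rhoM mulVg rho1. Qed.

Lemma rhoVK w x : rho w (rho w^-1%g x) = x.
Proof. by rewrite -rhoM mulgV rho1. Qed.

Lemma rho_linear w : linear (rho w).
Proof. by have [] := std_repP R coxWS. Qed.

Lemma rho0 w : rho w 0 = 0.
Proof. by have := rho_linear w (-1) 0 0; rewrite scaler0 addr0 scaleN1r addNr. Qed.

Lemma rhoD w x y : rho w (x + y) = rho w x + rho w y.
Proof. by have := rho_linear w 1 x y; rewrite !scale1r. Qed.

Lemma rhoZ w (a : R) x : rho w (a *: x) = a *: rho w x.
Proof. by rewrite -[a *: x]addr0 rho_linear rho0 addr0. Qed.

Lemma rhoN w x : rho w (- x) = - rho w x.
Proof. by rewrite -scaleN1r rhoZ scaleN1r. Qed.

Lemma simple_refl_root s t :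
  simple_refl s (alpha t) = alpha t - (2 * cox_gram R s t) *: alpha s.
Proof. by rewrite /simple_refl cox_form_simple. Qed.

Lemma rho_gen_root s : rho (val s) (alpha s) = - alpha s.
Proof.
rewrite rho_gen simple_refl_root (cox_gramss R coxWS) mulr1.
by rewrite scaler_nat mulr2n opprD addrA subrr add0r.
Qed.

Lemma rhoMgen w s : rho (w * val s)%g (alpha s) = - rho w (alpha s).
Proof. by rewrite rhoM rho_gen_root rhoN. Qed.

Definition nonneg x := forall s, 0 <= coeff s x.

Lemma nonneg_root s : nonneg (alpha s).
Proof. by move=> t; rewrite coeffU mul1r ler0n. Qed.

Lemma nonneg_comb (a b : R) x y :
  0 <= a -> 0 <= b -> nonneg x -> nonneg y -> nonneg (a *: x + b *: y).
Proof. by move=> a0 b0 x0 y0 s; rewrite coeffD !coeffZ addr_ge0// mulr_ge0. Qed.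

(** In the span of [alpha s] and [alpha t], each further letter advances the pair of coordinates by
    one step of the recurrence; [z n] is the Chebyshev value [U_(n-1)] at [c]. *)
Lemma rho_alt s t (c : R) (z : nat -> R) k :
  cox_gram R s t = - c -> z 0 = 0 -> z 1%N = 1 ->
  (forall n, z n.+2 = 2 * c * z n.+1 - z n) ->
  rho (word_prod (alt s t k)) (alpha s) =
  z k.+1 *: alpha (if odd k then t else s) + z k *: alpha (if odd k then s else t).
Proof.
move=> gst z0 z1 zS; elim: k => [|k IHk].
  by rewrite word_prod_nil rho1 z0 z1 scale1r scale0r addr0.
have step a b : cox_gram R a b = - c ->
    rho (val a) (z k.+1 *: alpha b + z k *: alpha a) =
    z k.+2 *: alpha a + z k.+1 *: alpha b.
  move=> gab; rewrite rhoD !rhoZ rho_gen_root rho_gen simple_refl_root gab zS.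
  rewrite scalerBr scalerA scalerN -addrA -opprD -scalerDl [RHS]addrC -scaleNr.
  by congr (_ + _ *: _); ring.
rewrite /= word_prod_cons rhoM IHk; case: odd => /=; rewrite step//.
by rewrite cox_gramC.
Qed.

(** For infinite order, encoded by 0, the form takes the value -1 and [z n = n] works. Otherwise
    [z n = sin (n th) / sin th] with [th = pi / coxm s t], which is nonnegative while [n th] stays
    in [[0, pi]]. *)
Lemma alt_coef_ex s t : s != t -> exists2 z : nat -> R,
  [/\ z 0 = 0, z 1%N = 1 & forall n, z n.+2 = 2 * - cox_gram R s t * z n.+1 - z n] &
  forall n, (coxm s t == 0 \/ n <= coxm s t)%N -> 0 <= z n.
Proof.
move=> st; have [m0|m0] := eqVneq (coxm s t) 0%N.
  exists (fun n => n%:R) => [|n _]; last exact: ler0n.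
  split=> // n; rewrite /cox_gram m0 eqxx -!natr1; ring.
have m1 : (1 < coxm s t)%N by rewrite ltn_neqAle eq_sym (coxm_gt1 coxWS)// lt0n.
pose th : R := pi / (coxm s t)%:R.
have mR : (1 : R) < (coxm s t)%:R by rewrite ltr1n.
have th0 : 0 <= th by rewrite divr_ge0// pi_ge0.
have sth : 0 < sin th.
  rewrite sin_gt0_pi// divr_gt0 ?pi_gt0 ?(lt_trans ltr01)//=.
  by rewrite ltr_pdivrMr ?(lt_trans ltr01)// ltr_pMr ?pi_gt0.
have gst : - cox_gram R s t = cos th by rewrite /cox_gram (negPf m0) opprK.
exists (fun n => sin (n%:R * th) / sin th).
  split; rewrite ?mul0r ?sin0 ?mul0r// ?mul1r ?divff ?gt_eqF// => n.
  rewrite gst -!natr1 !mulrDl !mul1r !sinD !cosD.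
  move: (sin2cos2 th); set c := cos th; set d := sin th => cd.
  have d0 : d != 0 by rewrite gt_eqF.
  by field : cd.
move=> n []// nm.
rewrite divr_ge0 ?(ltW sth)// sin_ge0_pi// mulr_ge0//=.
by rewrite mulrCA ger_pMr ?pi_gt0// ler_pdivrMr ?mul1r ?ler_nat// (lt_trans ltr01).
Qed.

(* Humphreys, "Reflection groups and Coxeter groups", Theorem 5.4: strip from [w]
   its longest alternating suffix in [s] and [t]; what remains does not get
   shorter on the right by [s] or [t], so induction applies to it, while the
   suffix, being shorter than [coxm s t], maps [alpha s] into the cone spanned
   by [alpha s] and [alpha t]. *)
Lemma len_gt_nonneg w s : (len w < len (w * val s)%g)%N -> nonneg (rho w (alpha s)).
Proof.
move: {2}(len w) (leqnn (len w)) => n.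
elim: n w s => [|n IHn] w s.
  by rewrite leqn0 => /eqP/len0 -> _; rewrite rho1; exact: nonneg_root.
move=> wn ws; have [w0|w0] := posnP (len w).
  by rewrite (len0 w0) rho1; exact: nonneg_root.
have [e ew le] := len_word coxWS w.
case/lastP: e ew le => [_ /=|e t ew le]; first by move=> /esym; move: w0; case: len.
have wt : (len (w * val t)%g < len w)%N.
  by rewrite -le -ew word_prod_rcons (mulg_genK coxWS) size_rcons ltnS len_word_prod.
have st : s != t by apply/eqP => st; move: ws; rewrite st ltnNge (ltnW wt).
pose suffix k := exists2 v, w = (v * word_prod (alt s t k))%g & len w = (len v + k)%N.
have suffixP k : `[< suffix k >] -> (k <= len w)%N.
  by move=> /asboolP[v _ ->]; exact: leq_addl.
have suffix1 : `[< suffix 1%N >].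
  apply/asboolP; exists (w * val t)%g.
    by rewrite -[alt s t 1]/[:: t] word_prod1 mulg_genK.
  by have := len_mulr_gen coxWS w t; lia.
(* The first letter of the suffix moves into [v]. This must lengthen [v], as otherwise [w] would
   have a word that is too short. *)
have suffixW k : suffix k.+1 -> suffix k.
  case=> v wv lv; exists (v * val (if odd k then s else t))%g.
    by rewrite wv /= word_prod_cons mulgA.
  have := lenM coxWS (v * val (if odd k then s else t))%g (word_prod (alt s t k)).
  rewrite -mulgA -word_prod_cons -/(alt s t k.+1) -wv.
  have := len_word_prod coxWS (alt s t k); rewrite size_alt.
  have := len_mulr_gen coxWS v (if odd k then s else t).
  lia.
have suffix_ex : exists k, `[< suffix k >] by exists 1%N.
have [k /asboolP[v wv lv] kmax] := ex_maxnP suffix_ex suffixP.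
have k0 : (0 < k)%N := kmax _ suffix1.
(* A suffix of length [coxm s t] could be rewritten by the braid relation to end in [s],
   contradicting that [s] lengthens [w]. *)
have km : coxm s t = 0%N \/ (k < coxm s t)%N.
  have [->|m0] := posnP (coxm s t); [by left|right; rewrite ltnNge; apply/negP => mk].
  have [u wu lu] : suffix (coxm s t).
    have [j kj] : exists j, k = (j + coxm s t)%N by exists (k - coxm s t)%N; rewrite subnK.
    have : suffix (j + coxm s t)%N by exists v; rewrite -kj.
    by elim: j {kj} => // j IHj /suffixW.
  move: ws; rewrite {2}wu alt_coxm// lu; case: (coxm s t) m0 => // m _.
  rewrite altSr word_prod_rcons mulgA mulg_genK// ltnNge.
  rewrite (leq_trans (lenM _ _ _))// leq_add2l (leq_trans (len_word_prod _ _))//.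
  by rewrite size_alt.
have [z [z0 z1 zS] zge0] := alt_coef_ex st.
rewrite wv rhoM (rho_alt k _ z0 z1 zS) ?opprK// rhoD !rhoZ.
have lvw : (len v <= n)%N by rewrite -ltnS (leq_trans _ wn)// lv -addn1 leq_add2l.
apply: nonneg_comb; try by apply: zge0; case: km => [->|]; [left|right; lia].
(* This letter is the first one of the suffix: if it shortened [v], absorbing it would give a word
   for [w] shorter than [len w]. *)
- apply: IHn => //; case: k {kmax z0 z1 zS zge0 km} k0 wv lv => // k _ wv lv.
  have [->//|lva] := len_mulr_gen coxWS v (if odd k.+1 then t else s).
  have := lenM coxWS (v * val (if odd k.+1 then t else s))%g (word_prod (alt s t k)).
  rewrite -mulgA -word_prod_cons.
  have -> : (if odd k.+1 then t else s) :: alt s t k = alt s t k.+1.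
    by rewrite /=; case: odd.
  have := len_word_prod coxWS (alt s t k); rewrite size_alt -wv lv.
  by move: lva; rewrite /=; case: odd => /=; lia.
(* If this letter shortened [v], it could be split off and prepended to the suffix, against the
   maximality of [k]. *)
- apply: IHn => //.
  have [->//|lvb] := len_mulr_gen coxWS v (if odd k then s else t).
  suff /kmax : `[< suffix k.+1 >] by rewrite ltnn.
  apply/asboolP; exists (v * val (if odd k then s else t))%g; last by lia.
  by rewrite /= word_prod_cons mulgA mulg_genK.
Qed.

End Positivity.

(** * Signs of roots, the invariant form and inversion sets *)

Section Inversions.
Variables (R : realType) (W : groupType) (S : set W).
Hypothesis coxWS : coxeter_system S.
Local Open Scope classical_set_scope.
Local Open Scope ring_scope.
Local Notation V := {freeg S / R}.
Local Notation rho := (std_rep R S).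
Local Notation alpha := (@simple_root R W S).
Local Notation len := (len coxWS).
Local Notation inv := (@inversions R W S).
Implicit Types (u v w : W) (s t : S) (x y : V).

Lemma len_lt_nonpos w s : (len (w * val s)%g < len w)%N -> nonneg (- rho w (alpha s)).
Proof.
move=> ws; rewrite -rhoMgen//; apply: len_gt_nonneg.
by rewrite mulg_genK.
Qed.

Lemma nonneg_anti x : nonneg x -> nonneg (- x) -> x = 0.
Proof.
move=> x0 nx0; apply/eqP/freeg_eqP => s; rewrite coeff0.
by apply/eqP; rewrite eq_le x0 andbT -oppr_ge0 -coeffN.
Qed.

Lemma root_gen s : root_system R S (alpha s).
Proof. by exists 1%g, s; rewrite rho1. Qed.

Lemma rho_root w x : root_system R S x -> root_system R S (rho w x).
Proof. by move=> [v [s ->]]; exists (w * v)%g, s; rewrite rhoM. Qed.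

Lemma rootN x : root_system R S x -> root_system R S (- x).
Proof. by move=> [v [s ->]]; exists (v * val s)%g, s; rewrite rhoMgen. Qed.

Lemma root_neq0 x : root_system R S x -> x <> 0.
Proof.
move=> [v [s ->]] /(congr1 (rho v^-1%g)); rewrite rhoK// rho0// => /eqP.
by rewrite freegU_eq0 oner_eq0.
Qed.

Lemma root_sign x : root_system R S x -> nonneg x \/ nonneg (- x).
Proof.
move=> [v [s ->]]; have [vs|vs] := len_mulr_gen coxWS v s.
  by left; apply: len_gt_nonneg; rewrite vs.
by right; apply: len_lt_nonpos; rewrite vs.
Qed.

Lemma fgliftE (f : S -> R^o) x : fglift f x = \sum_(s <- dom x) coeff s x * f s.
Proof.
rewrite -{1}[x]freeg_sumE (big_morph (fglift f) (fgliftD f) (_ : _ = 0)); last first.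
  by have := lift_is_additive f 0 0; rewrite !subrr.
by apply: eq_bigr => s _; rewrite liftU.
Qed.

Lemma cox_form_linearl (a : R) x y z :
  cox_form (a *: x + y) z = a * cox_form x z + cox_form y z.
Proof. exact: fglift_linear. Qed.

Lemma cox_form_linearr (a : R) x y z :
  cox_form z (a *: x + y) = a * cox_form z x + cox_form z y.
Proof.
rewrite /cox_form !fgliftE mulr_sumr -big_split; apply: eq_bigr => s _ /=.
by rewrite fglift_linear mulrDr mulrCA.
Qed.

(** Symmetry against simple roots suffices for the invariance of the form under simple
    reflections. *)
Lemma cox_form_rootC x s : cox_form x (alpha s) = cox_form (alpha s) x.
Proof.
rewrite cox_formE /cox_form !fgliftE; apply: eq_bigr => t _.
by rewrite liftU scale1r cox_gramC.
Qed.

Lemma cox_form_refl x s : cox_form (simple_refl s x) (simple_refl s x) = cox_form x x.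
Proof.
rewrite /simple_refl addrC -scaleNr !(cox_form_linearl, cox_form_linearr).
rewrite cox_form_rootC cox_form_simple cox_gramss//; ring.
Qed.

Lemma cox_form_rho w x : cox_form (rho w x) (rho w x) = cox_form x x.
Proof.
have [e <-] := cox_gen coxWS w; elim: e => [|s e IHe].
  by rewrite word_prod_nil rho1.
by rewrite word_prod_cons rhoM// rho_gen// cox_form_refl.
Qed.

Lemma cox_form_root x : root_system R S x -> cox_form x x = 1.
Proof. by move=> [w [s ->]]; rewrite cox_form_rho cox_form_simple cox_gramss. Qed.

(* [s] changes the coefficient at [s] only, so a positive root made negative by
   [s] is a multiple of [alpha s], hence [alpha s] itself, as roots have norm 1. *)
Lemma pos_root_gen s x :
  pos_root R S x -> x <> alpha s -> pos_root R S (rho (val s) x).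
Proof.
move=> [rx x0] xs; have rsx := rho_root (val s) rx.
split=> //; have [//|sx0] := root_sign rsx; case: xs.
have xE : x = coeff s x *: alpha s.
  apply/eqP/freeg_eqP => t; rewrite coeffZ coeffU mul1r.
  have [<-|st] := eqVneq s t; first by rewrite mulr1.
  rewrite mulr0; apply/eqP; rewrite eq_le x0 andbT.
  have := sx0 t; rewrite rho_gen// coeffN coeffB coeffZ coeffU (negPf st) !mulr0 subr0.
  by rewrite oppr_ge0.
have := cox_form_root rx; rewrite xE -[_ *: _]addr0.
rewrite cox_form_linearl cox_form_linearr.
have form0 y : cox_form y 0 = 0.
  by have := cox_form_linearr (-1) 0 0 y; rewrite scaler0 addr0 mulN1r addNr.
have form0l y : cox_form 0 y = 0.
  by have := cox_form_linearl (-1) 0 0 y; rewrite scaler0 addr0 mulN1r addNr.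
rewrite form0 form0l cox_form_simple cox_gramss// !addr0 mulr1 => /eqP.
rewrite -expr2 sqrf_eq1 => /orP[/eqP ->|/eqP cN1]; first by rewrite scale1r.
by have := x0 s; rewrite cN1 lerNr oppr0 ler10.
Qed.

Lemma inversionsP w x : inv w x <->
  [/\ root_system R S x, nonneg x & nonneg (- rho w^-1%g x)].
Proof.
split=> [[[rx x0] [_ wx0]]//|[rx x0 wx0]]; do !split=> //.
exact/rootN/rho_root.
Qed.

Lemma inversions1 : inv 1%g = set0.
Proof.
apply/seteqP; split=> // x /inversionsP[rx x0]; rewrite invg1 rho1// => nx0.
by case: (root_neq0 rx); exact: nonneg_anti.
Qed.

(** The reflection [s] keeps every positive root other than [alpha s] positive, so only the root
    [rho u (alpha s)] is gained and none is lost. *)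
Lemma inversions_mulr u s : len (u * val s)%g = (len u).+1 ->
  inv (u * val s)%g = inv u `|` [set rho u (alpha s)].
Proof.
move=> us; have us0 : nonneg (rho u (alpha s)).
  by apply: len_gt_nonneg; rewrite us.
have rus := rho_root u (root_gen s).
apply/seteqP; split=> x.
  move=> /inversionsP[rx x0]; rewrite invgM (gen_inv coxWS) rhoM// => usx0.
  have [ux0|ux0] := root_sign (rho_root u^-1%g rx); last by left; apply/inversionsP.
  right; rewrite /= -[x](rhoVK coxWS u); congr (rho u _); apply: contrapT => uxs.
  have [rsx sx0] := pos_root_gen (conj (rho_root u^-1%g rx) ux0) uxs.
  by apply: (root_neq0 rsx); exact: nonneg_anti.
case=> [/inversionsP[rx x0 ux0]|->]; apply/inversionsP; split=> //;
    rewrite invgM (gen_inv coxWS) rhoM//; last first.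
  rewrite rhoK// rho_gen_root// opprK; exact: nonneg_root.
rewrite -rhoN//; apply: (pos_root_gen _ _).2.
  by split=> //; exact/rootN/rho_root.
move=> /(congr1 (rho u)); rewrite rhoN// rhoVK// => xE.
by apply: (root_neq0 rus); apply: nonneg_anti; [exact: us0 | rewrite -xE opprK].
Qed.

Lemma inversions_sub_mul u v :
  len (u * v)%g = (len u + len v)%N -> inv u `<=` inv (u * v)%g.
Proof.
move: v; apply: (@lenW_ind W S coxWS) => [_|v s vs IHv].
  by rewrite mulg1; exact: subset_refl.
rewrite mulgA vs => uvs.
have le1 := lenM coxWS u v.
have le2 := len_mulr_gen coxWS (u * v)%g s.
rewrite uvs in le2; have uv : len (u * v)%g = (len u + len v)%N by lia.
rewrite inversions_mulr; last by rewrite uvs uv addnS.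
by apply: (subset_trans (IHv uv)) => x; left.
Qed.

(** Inclusion of inversion sets makes [u] an initial factor of [v] with additive lengths. In the
    induction, with [z = u^-1 v], the new inversion says that [z^-1] makes [alpha s] negative, so
    [s] shortens [z^-1]. *)
Lemma len_inversions_sub u v :
  inv u `<=` inv v -> len v = (len u + len (u^-1 * v)%g)%N.
Proof.
move: u; apply: (@lenW_ind W S coxWS) => [_|u s us IHu].
  by rewrite len1 invg1 mul1g.
rewrite inversions_mulr// subUset => -[/IHu vE /(_ _ erefl)/inversionsP[_ _]].
set z := (u^-1 * v)%g in vE *.
have -> : (v^-1 = z^-1 * u^-1)%g by rewrite -invgM mulVKg.
rewrite rhoM// rhoK// => zs0.
have szE : ((u * val s)^-1 * v = (z^-1 * val s)^-1)%g.
  by rewrite [RHS]invgM [in LHS]invgM invgK !(gen_inv coxWS) -mulgA.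
rewrite szE lenV us vE -(lenV coxWS z) addSn -addnS; congr (_ + _)%N.
have [zs|//] := len_mulr_gen coxWS z^-1%g s.
case: (root_neq0 (rho_root z^-1%g (root_gen s))); apply: nonneg_anti => //.
by apply: len_gt_nonneg; rewrite zs.
Qed.

Lemma inversions_inj u v : inv u = inv v -> u = v.
Proof.
move=> uv.
have uE : len v = (len u + len (u^-1 * v)%g)%N by apply: len_inversions_sub; rewrite uv.
have vE : len u = (len v + len (v^-1 * u)%g)%N by apply: len_inversions_sub; rewrite uv.
have uv0 : (u^-1 * v)%g = 1%g by apply: (@len0 W S coxWS); lia.
by rewrite -[v](mulVKg u) uv0 mulg1.
Qed.

(** [inv u] gains one root per letter, hence is finite and already lies in one member of an
    increasing union. *)
Lemma inversions_compact u (F : nat -> set V) :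
  {homo F : m n / (m <= n)%N >-> m `<=` n} ->
  inv u `<=` \bigcup_n F n -> exists n, inv u `<=` F n.
Proof.
move=> Fle; move: u; apply: (@lenW_ind W S coxWS) => [_|u s us IHu].
  by exists 0%N; rewrite inversions1.
rewrite inversions_mulr// subUset => -[/IHu[m um] /(_ _ erefl)[n _ sn]].
exists (maxn m n); rewrite subUset; split.
  by apply: (subset_trans um); apply: Fle; exact: leq_maxl.
by move=> _ ->; apply: Fle sn; exact: leq_maxr.
Qed.

Lemma inversions_take (e : seq S) k : reduced_expr e ->
  inv (word_prod (take k e)) `<=` inv (word_prod e).
Proof.
move=> red; rewrite -{2}[e](cat_take_drop k) word_prod_cat.
apply: inversions_sub_mul; apply/eqP; rewrite eqn_leq lenM/=.
rewrite -word_prod_cat cat_take_drop ((reduced_exprE coxWS e).1 red).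
by rewrite -{3}[e](cat_take_drop k) size_cat leq_add// len_word_prod.
Qed.

(** * Prefixes of an infinite reduced expression *)

Section InfiniteWords.
Variable a : inf_reduced S.
Local Notation prefix n := (word_prod (mkseq (val a) n)).

Lemma inf_reduced_mkseq n : reduced_expr (mkseq (val a) n).
Proof. by case: n => // n; exact: (set_valP a). Qed.

Lemma len_prefix n : len (prefix n) = n.
Proof. by rewrite ((reduced_exprE coxWS _).1 (@inf_reduced_mkseq n)) size_mkseq. Qed.

Lemma inversions_prefix :
  {homo (fun n => inv (prefix n)) : m n / (m <= n)%N >-> m `<=` n}.
Proof.
move=> m n mn; have -> : mkseq (val a) m = take m (mkseq (val a) n).
  by rewrite -map_take take_iota (minn_idPl mn).
exact/inversions_take/inf_reduced_mkseq.
Qed.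

(** The empty prefix may join the union, since its inversions are among those of the next prefix. *)
Lemma inf_inversionsE : inf_inversions (R := R) a = \bigcup_n inv (prefix n).
Proof.
apply/seteqP; split=> x [n _ xn]; first by exists n.
by exists n.+1 => //; exact: inversions_prefix xn.
Qed.

End InfiniteWords.

(** Makes the weak order antisymmetric, as maximality is stated with an equality. An infinite word
    cannot share its inversion set with [w]: its prefix of length [len w + 1] would be below [w]. *)
Lemma Wbar_inversions_inj : injective (@Wbar_inversions R W S).
Proof.
have fin_inf (c : inf_word R S) w : inf_word_inversions c <> inv w.
  move=> cw; have := len_prefix (repr c) (len w).+1.
  have /len_inversions_sub : inv (word_prod (mkseq (val (repr c)) (len w).+1)) `<=` inv w.
    by rewrite -cw /inf_word_inversions inf_inversionsE => x xk; exists (len w).+1.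
  by move=> + kE; rewrite kE; lia.
case=> [c|u] [d|v] /=; last by move=> /inversions_inj ->.
- move=> cd; congr inl; rewrite -[c]reprK -[d]reprK.
  by apply/eqmodP; exact/asboolP.
- by move=> /fin_inf.
- by move=> /esym/fin_inf.
Qed.

End Inversions.

(** * Directed sets and maximal elements *)

Section DirectedSets.
Variables (R : realType) (W : groupType) (S : set W).
Hypothesis coxWS : coxeter_system S.
Local Open Scope classical_set_scope.
Local Notation inv := (@inversions R W S).
Local Notation Wbar := (Wbar R S).
Implicit Types (u v w : W) (x y : Wbar) (D : set W).

Definition directed D := D !=set0 /\
  forall u v, D u -> D v -> exists2 w, D w & inv u `<=` inv w /\ inv v `<=` inv w.

Definition below x : set W := [set u | inv u `<=` Wbar_inversions x].

(** By compactness, two elements below an infinite word lie below a common prefix; below an element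
    of [W], that element itself is the bound. *)
Lemma below_directed x : directed (below x).
Proof.
split; first by exists 1%g => u; rewrite inversions1.
case: x => [c|w] u v ux vx; last by exists w => //; exact: subset_refl.
rewrite /below/= /inf_word_inversions inf_inversionsE// in ux vx *.
have homo := inversions_prefix (R := R) coxWS (a := repr c).
have [m um] := inversions_compact coxWS homo ux.
have [n vn] := inversions_compact coxWS homo vx.
exists (word_prod (mkseq (val (repr c)) (maxn m n))).
  by move=> z zmn; exists (maxn m n).
by split; [apply: (subset_trans um) | apply: (subset_trans vn)];
  apply: homo; rewrite ?leq_maxl ?leq_maxr.
Qed.

Lemma below_cover x : \bigcup_(u in below x) inv u = Wbar_inversions x.
Proof.
apply/seteqP; split=> z; first by move=> [u]; exact.
case: x => [c|w]; last by exists w => //; exact: subset_refl.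
move=> zc; have := zc; rewrite /= /inf_word_inversions inf_inversionsE// => -[n _ zn].
exists (word_prod (mkseq (val (repr c)) n)) => // t tn.
by rewrite /= /inf_word_inversions inf_inversionsE//; exists n.
Qed.

(** Each element is coded by one chosen word over the countable alphabet. *)
Lemma countable_group : countable S -> exists f : W -> nat, injective f.
Proof.
move=> /countable_injP[g ginj]; have [word wordP] := choice (cox_gen coxWS).
exists (fun w => pickle (map (g \o val) (word w))) => u v /(pcan_inj pickleK).
move=> /inj_map uv; rewrite -[u]wordP -[v]wordP uv// => s t /ginj st.
by apply: val_inj; apply: st; exact: valP.
Qed.

Lemma Wbar_of_directed D : countable S -> directed D ->
  exists x, Wbar_inversions x = \bigcup_(u in D) inv u.
Proof.
move=> /countable_group[f finj] [[d0 Dd0] Ddir].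
have [[w Dw wmax]|nomax] := pselect
    (exists2 w, D w & forall u, D u -> inv u `<=` inv w).
  exists (inr w); apply/seteqP; split=> z; first by exists w.
  by move=> [u /wmax]; exact.
pose word_in_D (e : seq S) := reduced_expr e /\ D (word_prod e).
(* One stage of the construction: a word in [D] is strictly extended inside [D] so as to dominate
   the element with code [p.1], if there is one. Other words get the dummy value [[::]], so that
   choice applies to all pairs. *)
have step (p : nat * seq S) : exists e', word_in_D p.2 ->
    [/\ word_in_D e', exists r, e' = p.2 ++ r, (size p.2 < size e')%N
      & forall u, D u -> f u = p.1 -> inv u `<=` inv (word_prod e')].
  case: p => n e /=; have [[red De]|] := pselect (word_in_D e); last by exists [::].
  have [u Du ue] : exists2 u, D u & ~ inv u `<=` inv (word_prod e).
    apply: contrapT => h; apply: nomax; exists (word_prod e) => // u Du.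
    by apply: contrapT => ue; apply: h; exists u.
  (* When no element of [D] has code [n], [d0] serves and the condition is void. *)
  have [v Dv vn] : exists2 v, D v & forall u, D u -> f u = n -> inv u `<=` inv v.
    have [[v [Dv vn]]|no] := pselect (exists v, D v /\ f v = n).
      by exists v => // u' _ u'n; rewrite (finj u' v) ?u'n.
    by exists d0 => // u' Du' u'n; case: no; exists u'.
  have [w1 Dw1 [ew1 uw1]] := Ddir _ _ De Du.
  have [w2 Dw2 [w12 vw2]] := Ddir _ _ Dw1 Dv.
  have ew2 := subset_trans ew1 w12; have uw2 := subset_trans uw1 w12.
  have w2E := len_inversions_sub coxWS ew2.
  have [r rw lr] := len_word coxWS ((word_prod e)^-1 * w2)%g.
  have erw : word_prod (e ++ r) = w2 by rewrite word_prod_cat rw mulVKg.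
  exists (e ++ r) => _; split.
  - split; last by rewrite erw.
    apply/(reduced_exprE coxWS).
    by rewrite erw w2E ((reduced_exprE coxWS e).1 red) size_cat lr.
  - by exists r.
  - rewrite size_cat -[ltnLHS]addn0 ltn_add2l lt0n; apply/eqP => /size0nil r0.
    by apply: ue; move: uw2; rewrite -erw r0 cats0.
  - by rewrite erw => u' Du' u'n; apply: (subset_trans (vn u' Du' u'n)).
have [next nextP] := choice step.
have [e0 e0d e0l] := len_word coxWS d0.
pose E := fix E n := if n is n'.+1 then next (n', E n') else e0.
have EP n : word_in_D (E n).
  elim: n => [|n IHn]; last by have [] := nextP (n, E n) IHn.
  by split; rewrite /= ?e0d//; apply/(reduced_exprE coxWS); rewrite e0d.
have Esize n : (n <= size (E n))%N.
  by elim: n => // n IHn; have [_ _ /(leq_ltn_trans IHn)] := nextP (n, E n) (EP n).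
have Eprefix m n : (m <= n)%N -> exists r, E n = E m ++ r.
  move=> /subnKC <-; elim: (n - m)%N => [|k [r IHk]].
    by exists [::]; rewrite addn0 cats0.
  have [_ [r' r'E] _ _] := nextP ((m + k)%N, E (m + k)%N) (EP _).
  by exists (r ++ r'); rewrite addnS [LHS]r'E /= IHk catA.
have [s0 _] : exists s0 : S, True.
  by have := Esize 1%N; case: (E 1%N) => // s0; exists s0.
(* [E n.+1] has at least [n.+1] letters, so the default [s0] is never read. *)
pose a n := nth s0 (E n.+1) n.
have aE k n : (k <= size (E n))%N -> mkseq a k = take k (E n).
  move=> kn; apply: (@eq_from_nth _ s0); first by rewrite size_mkseq size_takel.
  rewrite size_mkseq => i ik; rewrite nth_mkseq// nth_take// /a.
  (* One of [E i.+1] and [E n] is a prefix of the other and both reach position [i], so they agree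
     there. *)
  have in_ := leq_trans ik kn; have [le|/ltnW le] := leqP i.+1 n;
    have [r ->] := Eprefix _ _ le; rewrite nth_cat ?in_//.
  by rewrite Esize.
have a_red : inf_reduced S a.
  move=> k _; rewrite (aE k k (Esize k)).
  by apply: reduced_take; have [] := EP k.
pose ia : inf_reduced S := exist _ a (mem_set a_red).
exists (inl (\pi_(inf_word R S)%qT ia)).
rewrite /= inf_word_inversions_pi inf_inversionsE//.
apply/seteqP; split=> z [k].
  move=> _; rewrite /= (aE k k (Esize k)) => zk.
  exists (word_prod (E k)); first by have [] := EP k.
  by apply: inversions_take zk => //; have [] := EP k.
(* The element [k] of [D] was absorbed at the stage numbered by its code. *)
move=> Dk zk; have [_ _ _ /(_ k Dk erefl)/(_ z zk) zE] := nextP (f k, E (f k)) (EP _).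
exists (size (E (f k).+1)) => //=.
by rewrite (aE _ (f k).+1)// take_size.
Qed.

(** Zorn runs over the sets [D] whose union with [below w] is directed; this forces the result above
    [w] and covers the empty chain as well. *)
Lemma weak_le_maximal : countable S ->
  forall w : Wbar, exists2 x, weak_maximal x & weak_le w x.
Proof.
move=> Scount w.
have chain (F : set (set W)) : F `<=` (fun D => directed (D `|` below w)) ->
    total_on F subset -> directed (\bigcup_(D in F) D `|` below w).
  move=> Fdir Ftot; split.
    by have [[u wu] _] := below_directed w; exists u; right.
  (* Two elements of the union already lie in one directed piece, because the chain is totally
     ordered. *)
  have pair u v : (\bigcup_(D in F) D `|` below w) u ->
      (\bigcup_(D in F) D `|` below w) v ->
      exists2 D, directed D & [/\ D u, D v & D `<=` \bigcup_(D in F) D `|` below w].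
    have FU D : F D -> D `|` below w `<=` \bigcup_(D in F) D `|` below w.
      by move=> FD z [zD|zw]; [left; exists D|right].
    move=> [[D FD Du]|wu] [[D' FD' Dv]|wv].
    - have [DD'|D'D] := Ftot _ _ FD FD'.
        exists (D' `|` below w); first exact: Fdir.
        by split; [left; exact: DD'|left|exact: FU].
      exists (D `|` below w); first exact: Fdir.
      by split; [left|left; exact: D'D|exact: FU].
    - by exists (D `|` below w); [exact: Fdir|split; [left|right|exact: FU]].
    - by exists (D' `|` below w); [exact: Fdir|split; [right|left|exact: FU]].
    - by exists (below w); [exact: below_directed|split=> // z; right].
  move=> u v /pair h /h[D [_ Ddir] [Du Dv DU]].
  by have [z Dz uvz] := Ddir _ _ Du Dv; exists z => //; exact: DU.
have [D [Ddir Dmax]] := Zorn_bigcup chain.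
have [x xE] := Wbar_of_directed Scount Ddir.
exists x.
  (* For [y] above [x], the directed set [below y] contains [D] and [below w]; maximality of [D]
     gives [below y] inside [D], so [y] has no inversions beyond those of [x]. *)
  move=> y xy; apply: (Wbar_inversions_inj coxWS); apply/seteqP; split=> //.
  have DDy : D `|` below w `<=` below y.
    by move=> u Du; apply: subset_trans xy; rewrite xE; exact: bigcup_sup.
  rewrite xE -(below_cover y); apply: bigcup_subset.
  move=> u yu; left; apply: contrapT => nDu; apply: (Dmax (below y)).
    split; first by move=> v Dv; apply: DDy; left.
    by move=> /(_ u yu).
  rewrite setUidl; first exact: below_directed.
  by move=> v wv; apply: DDy; right.
rewrite /weak_le xE -(below_cover w); apply: bigcup_subset => u; by right.
Qed.

End DirectedSets.

Local Open Scope classical_set_scope.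

Theorem proposition2p12 (R : realType) (W : groupType) (S : set W)
    (coxWS : coxeter_system S)
    (W_infinite : infinite_set [set: W])
    (S_countable : countable S) :
  (exists x : Wbar R S, weak_maximal x) /\
  (forall w : Wbar R S, exists2 x : Wbar R S, weak_maximal x & weak_le w x).
Proof.
have le_max := weak_le_maximal coxWS S_countable (R := R).
by split=> //; have [x xmax _] := le_max (inr 1%g); exists x.
Qed.
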